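(* Let $\beta>0$ and $\Lambda>0$, let $L\ge1$ be an integer and set $\tau:=\beta\Lambda/(2L)$. In the setting of the Pauli-path expansion described in the context (with this $\tau$ and an arbitrary sequence $P_1,\dots,P_L$, e.g. sampled by qDRIFT from a Hamiltonian $H=\sum_j h_jP^{(j)}$ with $\Lambda=\sum_j|h_j|$), let $k$ be an integer with $k>e\beta\Lambda/2$, let $\widetilde A_L:=\sum_{\gamma:\ r(\gamma)\le k}\mathrm{coef}(\gamma)Q_L(\gamma)$, and define $\rho:=A_L/\operatorname{Tr}(A_L)$, $\widetilde\rho:=\widetilde A_L/\operatorname{Tr}(\widetilde A_L)$. Set $$\varepsilon:=e^{\beta\Lambda/2}\Big(\frac{e\beta\Lambda}{2k}\Big)^{k}.$$ If $\varepsilon<1$, then $\|\rho-\widetilde\rho\|_1\le\frac{2\varepsilon}{1-\varepsilon}$; in particular $\|\rho-\widetilde\rho\|_1\in\mathcal O\big(e^{\beta\Lambda/2}(e\beta\Lambda/(2k))^k\big)$, and for every observable $O$, $|\operatorname{Tr}[O(\rho-\widetilde\rho)]|\le\|O\|_\infty\frac{2\varepsilon}{1-\varepsilon}$.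
   Context: Pauli-path expansion. Let $n\ge1$ and $\mathcal P_n=\{I,X,Y,Z\}^{\otimes n}$. Fix $\tau>0$, an integer $L\ge1$, and a sequence $P_1,\dots,P_L$ of Hermitian operators, each of the form $\pm P$ with $P\in\mathcal P_n\setminus\{I^{\otimes n}\}$. Define $\mathcal E_t(X)=e^{-\tau P_t/2}\,X\,e^{-\tau P_t/2}$ and $A_L:=\mathcal E_L\circ\cdots\circ\mathcal E_1(\mathbb I)$. For $Q\in\mathcal P_n$: if $P_t$ anticommutes with $Q$ then $\mathcal E_t(Q)=Q$; if $P_t$ commutes with $Q$ then $\mathcal E_t(Q)=\cosh(\tau)Q-\sinh(\tau)P_tQ$, where $P_tQ=s\,Q'$ for a unique sign $s\in\{\pm1\}$ and $Q'\in\mathcal P_n$. A Pauli path is a sequence $\gamma=(Q_0,Q_1,\dots,Q_L)$ of elements of $\mathcal P_n$ with $Q_0=\mathbb I$ such that for each $t\in\{1,\dots,L\}$ exactly one of the following holds: (a) $P_t$ anticommutes with $Q_{t-1}$ and $Q_t=Q_{t-1}$ (step factor $1$); (b) $P_t$ commutes with $Q_{t-1}$ and $Q_t=Q_{t-1}$ (step factor $\cosh\tau$); (c) $P_t$ commutes with $Q_{t-1}$ and $Q_t=Q'$ where $P_tQ_{t-1}=sQ'$ (step factor $-s\sinh\tau$; this is called a non-identity update). $\mathrm{coef}(\gamma)$ is the product of the $L$ step factors, $r(\gamma)$ is the number of non-identity updates, and $Q_t(\gamma)$ denotes the $t$-th entry. Then $A_L=\sum_\gamma\mathrm{coef}(\gamma)\,Q_L(\gamma)$,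 the sum ranging over all Pauli paths. *)

(* Defs.v *)
From HB Require Import structures.
From mathcomp Require Import all_boot all_order all_algebra.
From mathcomp Require Import complex sesquilinear spectral.
From mathcomp Require Import reals sequences exp.
Set Implicit Arguments. Unset Strict Implicit. Unset Printing Implicit Defensive.
Import Order.TTheory GRing.Theory Num.Theory.
Local Open Scope ring_scope.
Local Open Scope complex_scope.
Local Open Scope sesquilinear_scope.

Section PauliPaths.
Variable R : realType.
Local Notation C := R[i].

Definition coshR (x : R) : R := (expR x + expR (- x)) / 2.
Definition sinhR (x : R) : R := (expR x - expR (- x)) / 2.

(** single-qubit Pauli matrices: 0 = I, 1 = X, 2 = Y, 3 = Z *)
Definition sigma (a : 'I_4) : 'M[C]_2 :=
  \matrix_(i < 2, j < 2)
    match val a with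
    | 0 => if val i == val j then 1 else 0
    | 1 => if val i == val j then 0 else 1
    | 2 => if val i == val j then 0 else (if val i == 0 then - 'i else 'i)
    | _ => if val i == val j then (if val i == 0 then 1 else -1) else 0
    end.

Definition pauli (n : nat) := {ffun 'I_n -> 'I_4}.
Definition pauliI (n : nat) : pauli n := [ffun=> ord0].

Definition qbit n (i : 'I_(2 ^ n)) (k : 'I_n) : 'I_2 := inord ((i %/ 2 ^ k) %% 2).

(** matrix of a Pauli string: the n-fold Kronecker product of its factors *)
Definition pmat n (Q : pauli n) : 'M[C]_(2 ^ n) :=
  \matrix_(i, j) \prod_(k < n) sigma (Q k) (qbit i k) (qbit j k).

Definition spmat n (sP : bool * pauli n) : 'M[C]_(2 ^ n) :=
  (-1) ^+ sP.1 *: pmat sP.2.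

Definition commb n (A B : 'M[C]_(2 ^ n)) := A *m B == B *m A.
Definition anticommb n (A B : 'M[C]_(2 ^ n)) := A *m B == - (B *m A).

(** e^{-tau P/2} for P with P^2 = 1 (closed form of the exponential series) *)
Definition expHalf n (tau : R) (sP : bool * pauli n) : 'M[C]_(2 ^ n) :=
  (coshR (tau / 2))%:C%:M - (sinhR (tau / 2))%:C *: spmat sP.

Definition Emap n (tau : R) (sP : bool * pauli n) (X : 'M[C]_(2 ^ n)) :=
  expHalf tau sP *m X *m expHalf tau sP.

(** A_t = E_t o ... o E_1 (identity); Ps t is P_t for 1 <= t <= L *)
Fixpoint Aiter n (tau : R) (Ps : nat -> bool * pauli n) (t : nat) : 'M[C]_(2 ^ n) :=
  match t with
  | 0 => 1%:M
  | t'.+1 => Emap tau (Ps t'.+1) (Aiter tau Ps t')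
  end.

Definition step_ok n (sP : bool * pauli n) (Qp Qn : pauli n) : bool :=
  let Pm := spmat sP in
  [|| anticommb Pm (pmat Qp) && (Qn == Qp),
      commb Pm (pmat Qp) && (Qn == Qp)
    | commb Pm (pmat Qp) &&
      ((Pm *m pmat Qp == pmat Qn) || (Pm *m pmat Qp == - pmat Qn))].

(** step factor: 1 in case (a), cosh tau in case (b), -s sinh tau in case (c)
    where P_t Q_{t-1} = s Q_t *)
Definition step_factor n (tau : R) (sP : bool * pauli n) (Qp Qn : pauli n) : C :=
  let Pm := spmat sP in
  if Qn == Qp then
    (if anticommb Pm (pmat Qp) then 1 else (coshR tau)%:C)
  else if Pm *m pmat Qp == pmat Qn then - (sinhR tau)%:C
  else (sinhR tau)%:C.

(** a Pauli path gamma = (Q_0, ..., Q_L), Q_t = gamma (inord t) *)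
Definition ppath n L := {ffun 'I_L.+1 -> pauli n}.

Definition is_path n L (Ps : nat -> bool * pauli n) (g : ppath n L) : bool :=
  (g ord0 == pauliI n) &&
  [forall t : 'I_L, step_ok (Ps t.+1) (g (inord t)) (g (inord t.+1))].

Definition coef n L (tau : R) (Ps : nat -> bool * pauli n) (g : ppath n L) : C :=
  \prod_(t < L) step_factor tau (Ps t.+1) (g (inord t)) (g (inord t.+1)).

(** number of non-identity updates (steps of type (c), i.e. Q_t <> Q_{t-1}) *)
Definition rcount n L (g : ppath n L) : nat :=
  #|[set t : 'I_L | g (inord t.+1) != g (inord t)]|.

Definition Atrunc n L (tau : R) (Ps : nat -> bool * pauli n) (k : nat)
  : 'M[C]_(2 ^ n) :=
  \sum_(g : ppath n L | is_path Ps g && (rcount g <= k)%N)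
     coef tau Ps g *: pmat (g ord_max).

Definition normalize m (X : 'M[C]_m) : 'M[C]_m := (\tr X)^-1 *: X.

Definition singvals m (X : 'M[C]_m) : 'I_m -> R :=
  fun i => complex.Re (sqrtC (spectral_diag (X ^t* *m X) 0 i)).

Definition trnorm m (X : 'M[C]_m) : R := \sum_(i < m) singvals X i.
Definition opnorm m (X : 'M[C]_m) : R := \big[Num.max/0]_(i < m) singvals X i.

End PauliPaths.

(* Main.v *)
Require Import Defs.
From HB Require Import structures.
From mathcomp Require Import all_boot all_order all_algebra.
From mathcomp Require Import complex sesquilinear spectral.
From mathcomp Require Import reals sequences exp.
From mathcomp Require Import ring lra.
Set Implicit Arguments.
Unset Strict Implicit.
Unset Printing Implicit Defensive.

Import Order.TTheory GRing.Theory Num.Theory.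
Local Open Scope ring_scope.
Local Open Scope complex_scope.
Local Open Scope sesquilinear_scope.

(** Writing [x = beta * Lambda / 2 = tau * L], the generating function of the path
    weights by number of updates satisfies
    [\sum_gamma |coef gamma| * Z ^ r(gamma) <= (cosh tau + Z * sinh tau) ^ L <= exp (Z * x)]
    for [Z >= 1], so at [Z = k / x] the discarded paths have total weight at most
    [eta = (e * x / k) ^ k].  Since [A_L >= exp (- x)], this gives
    [|A_L - A'|_1 <= 2 ^ n * eta <= eps * \tr A_L], and normalizing costs the
    factor [2 / (1 - eps)].
    The trace norm is only used through duality: a partial isometry [W] with
    [\tr (W X) = |X|_1] reduces every estimate to Cauchy-Schwarz for the
    Hilbert-Schmidt inner product, applied to Pauli matrices and to the
    factorization [A_L = M M^*]. *)

(** * Hilbert-Schmidt norm and Cauchy-Schwarz for traces *)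

Section HilbertSchmidt.
Variable C : numClosedFieldType.

Lemma trmxCM m n p (A : 'M[C]_(m, n)) (B : 'M[C]_(n, p)) :
  (A *m B) ^t* = B ^t* *m A ^t*.
Proof. by rewrite trmx_mul map_mxM. Qed.

Lemma trmxC1 n : (1%:M : 'M[C]_n) ^t* = 1%:M.
Proof. by rewrite trmx1 map_mx1. Qed.

Lemma trmxCB m n (A B : 'M[C]_(m, n)) : (A - B) ^t* = A ^t* - B ^t*.
Proof. by rewrite linearB /= map_mxB. Qed.

Lemma trmxCZ m n a (A : 'M[C]_(m, n)) : (a *: A) ^t* = a^* *: A ^t*.
Proof. by rewrite linearZ /= map_mxZ. Qed.

Definition hsnorm2 m n (A : 'M[C]_(m, n)) : C := \tr (A *m A ^t* ).

Lemma hsnorm2E m n (A : 'M[C]_(m, n)) :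
  hsnorm2 A = \sum_i \sum_j `|A i j| ^+ 2.
Proof.
rewrite /hsnorm2 /mxtrace; apply: eq_bigr => i _; rewrite mxE.
by apply: eq_bigr => j _; rewrite !mxE normCK.
Qed.

Lemma hsnorm2_ge0 m n (A : 'M[C]_(m, n)) : 0 <= hsnorm2 A.
Proof.
by rewrite hsnorm2E; do 2!apply: sumr_ge0 => ? _; apply: exprn_ge0.
Qed.

Lemma hsnorm2_trmxC m n (A : 'M[C]_(m, n)) : hsnorm2 (A ^t* ) = hsnorm2 A.
Proof. by rewrite /hsnorm2 trmxCK mxtrace_mulC. Qed.

Lemma hsnorm2_dotmx m n (A : 'M[C]_(m, n)) :
  hsnorm2 A = dotmx (mxvec A) (mxvec A).
Proof.
rewrite hsnorm2E dotmxE mxE pair_bigA /=.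
rewrite (reindex _ (curry_mxvec_bij m n)) /=.
by apply: eq_bigr => -[i j] _; rewrite !mxE !mxvecE normCK.
Qed.

Lemma mxtrace_mul_dotmx m n (A : 'M[C]_(m, n)) (B : 'M[C]_(n, m)) :
  \tr (A *m B) = dotmx (mxvec A) (mxvec (B ^t* )).
Proof.
transitivity (\sum_i \sum_j A i j * B j i).
  by apply: eq_bigr => i _; rewrite mxE.
rewrite dotmxE mxE pair_bigA (reindex _ (curry_mxvec_bij m n)) /=.
by apply: eq_bigr => -[i j] _; rewrite !mxE !mxvecE !mxE conjCK.
Qed.

Lemma mxtrace_CauchySchwarz m n (A : 'M[C]_(m, n)) (B : 'M[C]_(n, m)) :
  `|\tr (A *m B)| ^+ 2 <= hsnorm2 A * hsnorm2 B.
Proof.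
rewrite mxtrace_mul_dotmx -(hsnorm2_trmxC B) !hsnorm2_dotmx.
exact: CauchySchwarz.
Qed.

Lemma mxtrace_CauchySchwarz_le m n (A : 'M[C]_(m, n)) (B : 'M[C]_(n, m)) a b :
  0 <= a -> 0 <= b -> hsnorm2 A <= a ^+ 2 -> hsnorm2 B <= b ^+ 2 ->
  `|\tr (A *m B)| <= a * b.
Proof.
move=> a0 b0 Aa Bb; rewrite -(@ler_pXn2r _ 2) ?nnegrE ?mulr_ge0 //.
apply: le_trans (mxtrace_CauchySchwarz _ _) _; rewrite exprMn.
by apply: ler_pM; rewrite ?hsnorm2_ge0.
Qed.

(** The right side minus the left is the squared norm of [(1 - p) M], because [1 - p] is again an
    orthogonal projector. *)
Lemma hsnorm2_mul_projector m n (p : 'M[C]_m) (M : 'M[C]_(m, n)) :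
  p *m p = p -> p ^t* = p -> \tr (p *m M *m M ^t* ) <= hsnorm2 M.
Proof.
move=> pp pC; rewrite -subr_ge0 /hsnorm2 -linearB /= -[X in _ <= \tr (X - _)]mul1mx.
rewrite -(mulmxA p) -mulmxBl.
have -> : 1%:M - p = (1%:M - p) ^t* *m (1%:M - p).
  by rewrite trmxCB trmxC1 pC mulmxBl !mulmxBr !mul1mx mulmx1 pp subrr subr0.
rewrite -mulmxA mxtrace_mulC -mulmxA -(mulmxA M) -trmxCM mulmxA.
exact: hsnorm2_ge0.
Qed.

End HilbertSchmidt.

(** * Singular values, trace-norm duality and the Hölder inequality *)

Section SingularValues.
Variable R : realType.
Local Notation C := R[i].

(** [V] diagonalizes [X^* X], so the columns of [X V^*] are orthogonal with the singular values as
    lengths. The estimates below rest on this half of the singular value decomposition. *)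
Lemma svd_right m (X : 'M[C]_m) : exists V : 'M[C]_m,
  [/\ V *m V ^t* = 1%:M, V ^t* *m V = 1%:M, (forall i, 0 <= singvals X i)
   & (X *m V ^t* ) ^t* *m (X *m V ^t* ) =
     diag_mx (\row_i (singvals X i)%:C ^+ 2)].
Proof.
have nX : X ^t* *m X \is normalmx.
  by apply/normalmxP; rewrite trmxCM trmxCK.
have := orthomx_spectralP nX; have VU := spectral_unitarymx (X ^t* *m X).
rewrite invmx_unitary //.
set V := spectralmx _ in VU *; set d := spectral_diag _ => dE.
have VV : V *m V ^t* = 1%:M by apply/unitarymxP.
have VV' : V ^t* *m V = 1%:M by apply: mulmx1C.
have YY : (X *m V ^t* ) ^t* *m (X *m V ^t* ) = diag_mx d.
  rewrite trmxCM trmxCK -!mulmxA (mulmxA _ X) dE -!mulmxA VV mulmx1.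
  by rewrite mulmxA VV mul1mx.
(* Each eigenvalue is a squared column length, hence nonnegative, so the real part taken in
   [singvals] loses nothing. *)
have d0 i : 0 <= d 0 i.
  have := congr1 (fun M : 'M_m => M i i) YY; rewrite !mxE eqxx mulr1n => <-.
  by apply: sumr_ge0 => j _; rewrite !mxE mulrC -normCK exprn_ge0.
have sE i : (singvals X i)%:C = sqrtC (d 0 i).
  by rewrite /singvals RRe_real // ger0_real // sqrtC_ge0.
exists V; split=> // [i|]; first by rewrite -lecR sE sqrtC_ge0.
rewrite YY; congr diag_mx; apply/rowP => i.
by rewrite mxE sE sqrtCK.
Qed.

(** [W] is the adjoint of the partial isometry in the polar decomposition of [X], so [W X = |X|].
    Its squared norm is the rank of [X], and left multiplication by it contracts because [W^* W] is
    a projector. *)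
Lemma trnorm_dual m (X : 'M[C]_m) : exists W : 'M[C]_m,
  [/\ \tr (W *m X) = (trnorm X)%:C, hsnorm2 W <= m%:R
   & forall n (M : 'M[C]_(m, n)), hsnorm2 (W *m M) <= hsnorm2 M].
Proof.
have [V [VV VV' s0 YY]] := svd_right X.
set Y := X *m V ^t* in YY.
pose s := singvals X.
(* Since [0^-1 = 0], this is the pseudo-inverse of the diagonal matrix of singular values; the
   nonzero rows of [Z] are then orthonormal. *)
pose T : 'M[C]_m := diag_mx (\row_i (s i)^-1%:C).
pose Z := T *m Y ^t*.
have TC : T ^t* = T.
  rewrite tr_diag_mx map_diag_mx; congr diag_mx; apply/rowP => i.
  by rewrite !mxE; apply/CrealP; rewrite complex_real.
have ZZ : Z *m Z ^t* = diag_mx (\row_i (s i != 0)%:R).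
  rewrite trmxCM trmxCK TC -mulmxA (mulmxA _ Y) YY !mulmx_diag.
  congr diag_mx; apply/rowP => i; rewrite !mxE -/s -rmorphXn -!rmorphM /=.
  have [->|si] := eqVneq (s i) 0; first by rewrite invr0 !mul0r.
  by rewrite mulrA expr2 mulrA mulVf // mul1r mulfV.
have DZ : diag_mx (\row_i (s i != 0)%:R) *m Z = Z.
  rewrite mulmxA mulmx_diag; congr (_ *m _); congr diag_mx.
  apply/rowP => i; rewrite !mxE.
  by have [->|_] := eqVneq (s i) 0; rewrite ?invr0 ?mul0r ?mul1r.
have ZY : Z *m Y = diag_mx (\row_i (s i)%:C).
  rewrite -mulmxA YY mulmx_diag; congr diag_mx; apply/rowP => i.
  rewrite !mxE -rmorphXn -rmorphM /= -/(s i); congr (_%:C).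
  have [->|si] := eqVneq (s i) 0; first by rewrite invr0 mul0r.
  by rewrite expr2 mulrA mulVf // mul1r.
clearbody Z; exists (V ^t* *m Z); split.
- have XE : X = Y *m V by rewrite -mulmxA VV' mulmx1.
  rewrite {1}XE -mulmxA mxtrace_mulC -!mulmxA VV mulmx1 ZY.
  rewrite mxtrace_diag /trnorm rmorph_sum /=; apply: eq_bigr => i _.
  by rewrite mxE.
- rewrite /hsnorm2 trmxCM trmxCK -mulmxA (mulmxA Z) mulmxA mxtrace_mulC mulmxA.
  rewrite VV mul1mx ZZ mxtrace_diag -[X in _ <= X%:R]card_ord -sum1_card.
  rewrite natr_sum; apply: ler_sum => i _; rewrite mxE ler_nat.
  by case: (_ != _).
- move=> n M.
  have -> : hsnorm2 (V ^t* *m Z *m M) = \tr (Z ^t* *m Z *m M *m M ^t* ).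
    rewrite /hsnorm2 mxtrace_mulC [in RHS]mxtrace_mulC trmxCM (trmxCM _ Z) (trmxCK V) !mulmxA.
    by rewrite -(mulmxA _ V) VV mulmx1.
  apply: hsnorm2_mul_projector.
    by rewrite -mulmxA (mulmxA Z) ZZ DZ.
  by rewrite trmxCM trmxCK.
Qed.

Lemma opnorm_ge0 m (O : 'M[C]_m) : 0 <= opnorm O.
Proof. by rewrite /opnorm; apply: bigmax_ge_id. Qed.

Lemma hsnorm2_mul_opnorm m n (O : 'M[C]_m) (y : 'M[C]_(m, n)) :
  hsnorm2 (O *m y) <= (opnorm O)%:C ^+ 2 * hsnorm2 y.
Proof.
have [V [VV VV' s0 YY]] := svd_right O.
have -> : hsnorm2 y = hsnorm2 (V *m y).
  by rewrite /hsnorm2 [RHS]mxtrace_mulC trmxCM -mulmxA (mulmxA _ V) VV' mul1mx mxtrace_mulC.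
set Y := O *m V ^t* in YY.
have OE : O = Y *m V by rewrite -mulmxA VV' mulmx1.
rewrite {1}OE -(mulmxA _ V); set w := V *m y; clearbody w.
rewrite {1}/hsnorm2 mxtrace_mulC trmxCM -mulmxA (mulmxA _ _ w) YY.
rewrite mxtrace_mulC mul_diag_mx -/(hsnorm2 w) hsnorm2E mulr_sumr.
apply: ler_sum => i _; rewrite !mxE mulr_sumr; apply: ler_sum => j _.
rewrite !mxE -mulrA -normCK; apply: ler_wpM2r; first exact: exprn_ge0.
rewrite -!rmorphXn lecR; apply: lerXn2r; rewrite ?nnegrE ?opnorm_ge0 //.
exact: le_bigmax.
Qed.

(** With [X = Y V], the trace splits into terms [row i V * O * col i Y]. The row has length 1 and
    the column has length the [i]-th singular value, so Cauchy-Schwarz applies term by term. *)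
Lemma mxtrace_mul_opnorm_trnorm m (O X : 'M[C]_m) :
  `|\tr (O *m X)| <= (opnorm O * trnorm X)%:C.
Proof.
have [V [VV VV' s0 YY]] := svd_right X.
set Y := X *m V ^t* in YY.
have -> : \tr (O *m X) = \sum_i \tr (row i V *m (O *m col i Y)).
  transitivity (\tr (V *m (O *m Y))).
    by rewrite [RHS]mxtrace_mulC -!mulmxA VV' mulmx1.
  apply: eq_bigr => i _; rewrite trace_mx11 !mxE.
  apply: eq_bigr => j _; rewrite !mxE; congr (_ * _).
  by apply: eq_bigr => l _; rewrite !mxE.
apply: le_trans (ler_norm_sum _ _ _) _.
rewrite /trnorm mulr_sumr rmorph_sum /=; apply: ler_sum => i _.
rewrite -[X in _ <= X]mul1r; apply: mxtrace_CauchySchwarz_le => //.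
- by rewrite ler0c mulr_ge0 ?opnorm_ge0.
- have := congr1 (fun M : 'M_m => M i i) VV; rewrite !mxE eqxx mulr1n => VVi.
  rewrite /hsnorm2 trace_mx11 mxE expr1n -VVi le_eqVlt; apply/orP; left.
  by apply/eqP; apply: eq_bigr => j _; rewrite !mxE.
- apply: le_trans (hsnorm2_mul_opnorm _ _) _.
  rewrite rmorphM exprMn; apply: ler_wpM2l.
    by rewrite exprn_ge0 // ler0c opnorm_ge0.
  have := congr1 (fun M : 'M_m => M i i) YY; rewrite !mxE eqxx mulr1n => <-.
  rewrite /hsnorm2 mxtrace_mulC trace_mx11 mxE le_eqVlt; apply/orP; left.
  by apply/eqP; apply: eq_bigr => j _; rewrite !mxE.
Qed.

End SingularValues.

(** * Pauli strings as Kronecker products *)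

Section PauliStrings.
Variable R : realType.
Local Notation C := R[i].

Lemma eq_bits n (i j : nat) : (i < 2 ^ n)%N -> (j < 2 ^ n)%N ->
  (forall k, (k < n)%N -> (i %/ 2 ^ k) %% 2 = (j %/ 2 ^ k) %% 2)%N -> i = j.
Proof.
elim: n i j => [|n IH] i j.
  by rewrite expn0 !ltnS !leqn0 => /eqP-> /eqP->.
rewrite expnSr => lti ltj eq_ij.
rewrite (divn_eq i 2) (divn_eq j 2); congr (_ * _ + _)%N.
  apply: IH => [||k ltk]; rewrite ?ltn_divLR //.
  by have := eq_ij k.+1 ltk; rewrite expnS !divnMA.
by have := eq_ij 0%N (ltn0Sn _); rewrite expn0 !divn1.
Qed.

Definition qbits n (i : 'I_(2 ^ n)) : {ffun 'I_n -> 'I_2} := [ffun k => qbit i k].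

Lemma qbits_bij n : bijective (@qbits n).
Proof.
apply: inj_card_bij; last by rewrite card_ffun !card_ord.
move=> i j eq_ij; apply/val_inj/(@eq_bits n); rewrite ?ltn_ord // => k ltk.
have := congr1 (fun f : {ffun 'I_n -> 'I_2} => (f (Ordinal ltk) : nat)) eq_ij.
by rewrite !ffunE /qbit !inordK ?ltn_mod.
Qed.

(** Indices correspond to bit vectors, so this is distributivity of products over sums. The product
    and trace rules for [kron] both come from it. *)
Lemma sum_qbits n (F : 'I_n -> 'I_2 -> C) :
  \sum_(i < 2 ^ n) \prod_k F k (qbit i k) = \prod_k \sum_b F k b.
Proof.
rewrite bigA_distr_bigA (reindex (@qbits n)) /=; last exact/onW_bij/qbits_bij.
by apply: eq_bigr => i _; apply: eq_bigr => k _; rewrite ffunE.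
Qed.

(** The factors are arbitrary, since a product of two Pauli matrices is one only up to a phase. *)
Definition kron n (F : 'I_n -> 'M[C]_2) : 'M[C]_(2 ^ n) :=
  \matrix_(i, j) \prod_k F k (qbit i k) (qbit j k).

Lemma pmatE n (Q : pauli n) : pmat R Q = kron (fun k => sigma R (Q k)).
Proof. by apply/matrixP => i j; rewrite !mxE. Qed.

Lemma eq_kron n (F G : 'I_n -> 'M[C]_2) : F =1 G -> kron F = kron G.
Proof.
move=> FG; apply/matrixP => i j; rewrite !mxE.
by apply: eq_bigr => k _; rewrite FG.
Qed.

Lemma kronM n (F G : 'I_n -> 'M[C]_2) :
  kron F *m kron G = kron (fun k => F k *m G k).
Proof.
apply/matrixP => i j; rewrite !mxE.
under [RHS]eq_bigr do rewrite mxE.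
rewrite -(sum_qbits (fun k b => F k (qbit i k) b * G k b (qbit j k))).
by apply: eq_bigr => l _; rewrite !mxE -big_split.
Qed.

Lemma mxtrace_kron n (F : 'I_n -> 'M[C]_2) : \tr (kron F) = \prod_k \tr (F k).
Proof.
rewrite -(sum_qbits (fun k b => F k b b)).
by apply: eq_bigr => i _; rewrite !mxE.
Qed.

Lemma kronZ n (c : 'I_n -> C) (F : 'I_n -> 'M[C]_2) :
  kron (fun k => c k *: F k) = (\prod_k c k) *: kron F.
Proof.
apply/matrixP => i j; rewrite !mxE -big_split.
by apply: eq_bigr => k _; rewrite mxE.
Qed.

Lemma trmxC_kron n (F : 'I_n -> 'M[C]_2) :
  (kron F) ^t* = kron (fun k => (F k) ^t* ).
Proof.
apply/matrixP => i j; rewrite !mxE rmorph_prod.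
by apply: eq_bigr => k _; rewrite !mxE.
Qed.

Lemma kron1 n : kron (fun _ : 'I_n => 1%:M) = 1%:M.
Proof.
apply/matrixP => i j; rewrite !mxE.
have [->|neq_ij] := eqVneq i j; first by apply: big1 => k _; rewrite mxE eqxx.
have [k neqk] : exists k, qbit i k != qbit j k.
  apply/existsP; rewrite -negb_forall; apply: contra neq_ij => /forallP eq_ij.
  apply/eqP/(bij_inj (@qbits_bij n))/ffunP => k; rewrite !ffunE.
  exact/eqP/eq_ij.
by rewrite (bigD1 k) //= mxE (negPf neqk) mul0r.
Qed.

Lemma matrix2P (A B : 'M[C]_2) :
  A 0 0 = B 0 0 -> A 0 1 = B 0 1 -> A 1 0 = B 1 0 -> A 1 1 = B 1 1 -> A = B.
Proof.
move=> *; apply/matrixP => i j.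
have ord2 (a : 'I_2) : a = 0 \/ a = 1.
  by case: a => [[|[|//]] ?]; [left | right]; apply: val_inj.
by case: (ord2 i) => ->; case: (ord2 j) => ->.
Qed.

Lemma ord4_ind (P : 'I_4 -> Prop) :
  P (@Ordinal 4 0 isT) -> P (@Ordinal 4 1 isT) -> P (@Ordinal 4 2 isT) ->
  P (@Ordinal 4 3 isT) -> forall a, P a.
Proof.
move=> P0 P1 P2 P3 [[|[|[|[|//]]]] lt4].
- by rewrite (_ : Ordinal lt4 = @Ordinal 4 0 isT) //; apply: val_inj.
- by rewrite (_ : Ordinal lt4 = @Ordinal 4 1 isT) //; apply: val_inj.
- by rewrite (_ : Ordinal lt4 = @Ordinal 4 2 isT) //; apply: val_inj.
- by rewrite (_ : Ordinal lt4 = @Ordinal 4 3 isT) //; apply: val_inj.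
Qed.

Lemma mul_ii : 'i%R * 'i%R = -1 :> C.
Proof. by rewrite -expr2 sqrCi. Qed.

Lemma conj_i : Num.conj ('i%R : C) = - 'i%R.
Proof. exact: conjCi. Qed.

Local Notation simp := (mul0r, mulr0, mul1r, mulr1, add0r, addr0, mulNr, mulrN, mul_ii,
  conj_i, conjC0, conjC1, opprK, oppr0) (only parsing).

Lemma sigmaC (a : 'I_4) : (sigma R a) ^t* = sigma R a.
Proof.
by elim/ord4_ind: a; apply: matrix2P;
  rewrite !mxE /= ?[in LHS]rmorphN /= ?complexiE ?simp.
Qed.

Lemma sigma0 : sigma R ord0 = 1%:M.
Proof. by apply: matrix2P; rewrite !mxE. Qed.

(** The phase is recorded only as a fourth root of unity: this passes to products over the tensor
    factors, and the nested square lets [z ^+ 2 = 1] or [-1] be read off later. *)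
Lemma sigma_mul (a b : 'I_4) : exists (c : 'I_4) (z : C),
  sigma R a *m sigma R b = z *: sigma R c /\ (z ^+ 2) ^+ 2 = 1.
Proof.
pose o0 := @Ordinal 4 0 isT; pose o1 := @Ordinal 4 1 isT.
pose o2 := @Ordinal 4 2 isT; pose o3 := @Ordinal 4 3 isT.
have sq1 : (1 ^+ 2) ^+ 2 = 1 :> C by rewrite !expr1n.
have sqi : ('i%R ^+ 2) ^+ 2 = 1 :> C by rewrite sqrCi sqrrN expr1n.
have sqNi : ((- 'i%R) ^+ 2) ^+ 2 = 1 :> C by rewrite sqrrN.
(* The witnesses form the Pauli multiplication table, one row for each [a]. *)
elim/ord4_ind: a; elim/ord4_ind: b;
  [exists o0, 1|exists o1, 1|exists o2, 1|exists o3, 1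
  |exists o1, 1|exists o0, 1|exists o3, 'i%R|exists o2, (- 'i%R)
  |exists o2, 1|exists o3, (- 'i%R)|exists o0, 1|exists o1, 'i%R
  |exists o3, 1|exists o2, 'i%R|exists o1, (- 'i%R)|exists o0, 1];
  (split; [apply: matrix2P|by []]);
  rewrite !mxE !big_ord_recl big_ord0 !mxE /= ?complexiE ?simp //.
Qed.

Lemma mxtrace_sigma_mul (a b : 'I_4) :
  \tr (sigma R a *m sigma R b) = if a == b then 2 else 0.
Proof.
elim/ord4_ind: a; elim/ord4_ind: b;
  rewrite /mxtrace !big_ord_recl big_ord0 !mxE !big_ord_recl !big_ord0 !mxE /=
    ?complexiE ?simp ?subrr ?addNr //.
Qed.

Lemma pmatC n (Q : pauli n) : (pmat R Q) ^t* = pmat R Q.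
Proof. by rewrite pmatE trmxC_kron; apply: eq_kron => k; rewrite sigmaC. Qed.

Lemma pmat_pauliI n : pmat R (pauliI n) = 1%:M.
Proof.
by rewrite pmatE -kron1; apply: eq_kron => k; rewrite ffunE sigma0.
Qed.

Lemma sigma_sqr (a : 'I_4) : sigma R a *m sigma R a = 1%:M.
Proof.
by elim/ord4_ind: a; apply: matrix2P;
  rewrite !mxE !big_ord_recl big_ord0 !mxE /= ?complexiE ?simp.
Qed.

Lemma pmat_sqr n (Q : pauli n) : pmat R Q *m pmat R Q = 1%:M.
Proof.
by rewrite pmatE kronM -kron1; apply: eq_kron => k; rewrite sigma_sqr.
Qed.

Lemma mxtrace_pmat_mul n (P Q : pauli n) :
  \tr (pmat R P *m pmat R Q) = if P == Q then (2 ^ n)%:R else 0.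
Proof.
rewrite !pmatE kronM mxtrace_kron.
have [->|neqPQ] := eqVneq P Q.
  under eq_bigr do rewrite mxtrace_sigma_mul eqxx.
  by rewrite big_const_ord natrX -Monoid.iteropE.
have [k neqk] : exists k, P k != Q k.
  apply/existsP; rewrite -negb_forall; apply: contra neqPQ => /forallP eqPQ.
  by apply/eqP/ffunP => k; apply/eqP/eqPQ.
by rewrite (bigD1 k) //= mxtrace_sigma_mul (negPf neqk) mul0r.
Qed.

(** Distinct strings are trace-orthogonal, so pairing both sides with [pmat R Q] would give
    [c * 2 ^ n = 0]. This turns matrix equations back into equalities of labels. *)
Lemma pmat_scale_inj n (P Q : pauli n) (c : C) :
  c != 0 -> pmat R P = c *: pmat R Q -> P = Q.
Proof.
move=> c0 eqPQ; apply/eqP; apply: contraT => neqPQ.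
have := mxtrace_pmat_mul P Q; rewrite (negPf neqPQ) eqPQ -scalemxAl linearZ /=.
rewrite mxtrace_pmat_mul eqxx => /eqP; rewrite mulf_eq0 (negPf c0) /=.
by rewrite pnatr_eq0 expn_eq0.
Qed.

Lemma pmat_mul n (P Q : pauli n) : exists (S : pauli n) (z : C),
  pmat R P *m pmat R Q = z *: pmat R S /\ (z ^+ 2) ^+ 2 = 1.
Proof.
have /fin_all_exists[S /fin_all_exists[z Sz]] k := sigma_mul (P k) (Q k).
exists [ffun k => S k], (\prod_k z k); split.
  rewrite !pmatE kronM -kronZ; apply: eq_kron => k.
  by rewrite ffunE; case: (Sz k).
by rewrite -!prodrXl; apply: big1 => k _; case: (Sz k).
Qed.

(** If [P Q = z S], then [Q P], its inverse, is [z^-1 S]. When [z ^+ 2 = 1] the two agree and [z] is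
    a sign; when [z ^+ 2 = -1] they are opposite. *)
Lemma pmat_comm_anticomm n (P Q : pauli n) :
  (pmat R P *m pmat R Q = pmat R Q *m pmat R P /\
   exists (S : pauli n) (s : bool),
     pmat R P *m pmat R Q = (-1) ^+ s *: pmat R S) \/
  pmat R P *m pmat R Q = - (pmat R Q *m pmat R P).
Proof.
have [S [z [PQ z4]]] := pmat_mul P Q.
have z0 : z != 0 by apply: contra_eq_neq z4 => ->; rewrite !expr0n eq_sym oner_eq0.
have QP : pmat R Q *m pmat R P = z^-1 *: pmat R S.
  have : pmat R P *m pmat R Q *m (pmat R Q *m pmat R P) = 1%:M.
    by rewrite mulmxA -(mulmxA (pmat R P)) pmat_sqr mulmx1 pmat_sqr.
  set W := pmat R Q *m _; rewrite PQ -scalemxAl => /(congr1 (fun M => z^-1 *: (pmat R S *m M))).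
  by rewrite -scalemxAr scalerA mulVf // scale1r mulmxA pmat_sqr mul1mx mulmx1.
move/eqP: z4; rewrite sqrf_eq1 => /orP[]/eqP z2.
  have zV : z^-1 = z by apply: (mulfI z0); rewrite mulfV // -expr2.
  left; rewrite QP zV PQ; split=> //; exists S.
  move/eqP: z2; rewrite sqrf_eq1 => /orP[]/eqP->; by [exists false | exists true].
right; rewrite QP PQ -scaleNr; congr (_ *: _).
by apply: (mulfI z0); rewrite mulrN mulfV // -expr2.
Qed.

End PauliStrings.

(** * Weighted sums over finite sequences *)

Section PathSums.
Variables (T : finType) (x0 : T) (K : comNzRingType) (V : lmodType K).

Definition ffun_rcons L (p : {ffun 'I_L.+1 -> T} * T) : {ffun 'I_L.+2 -> T} :=
  [ffun i : 'I_L.+2 => if (i <= L)%N then p.1 (inord i) else p.2].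

Lemma ffun_rcons_bij L : bijective (@ffun_rcons L).
Proof.
exists (fun h : {ffun 'I_L.+2 -> T} => ([ffun i : 'I_L.+1 => h (inord i)], h ord_max)).
  move=> [g x]; congr pair; last by rewrite ffunE /= ltnn.
  by apply/ffunP => i; rewrite !ffunE inordK ?ltnS ?(ltnW (ltn_ord i)) // -ltnS ltn_ord inord_val.
move=> h; apply/ffunP => i; rewrite ffunE /= ffunE.
case: leqP => [lei|gti]; first by rewrite inordK ?ltnS // inord_val.
congr (h _); apply: val_inj => /=; apply/eqP.
by rewrite eqn_leq gti -ltnS ltn_ord.
Qed.

Lemma ffun_rcons_inord L (g : {ffun 'I_L.+1 -> T}) x t : (t <= L)%N ->
  ffun_rcons (g, x) (inord t) = g (inord t).
Proof. by move=> leL; rewrite ffunE inordK ?leL // ltnS ltnW. Qed.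

Lemma ffun_rcons_max L (g : {ffun 'I_L.+1 -> T}) x :
  ffun_rcons (g, x) ord_max = x.
Proof. by rewrite ffunE /= ltnn. Qed.

(** A product of [L] transfer matrices started at [x0] and applied to [F]. Values in a module cover
    both the matrix expansion and scalar path weights. *)
Definition path_sum L (w : nat -> T -> T -> K) (F : T -> V) : V :=
  \sum_(g : {ffun 'I_L.+1 -> T} | g ord0 == x0)
    (\prod_(t < L) w t (g (inord t)) (g (inord t.+1))) *: F (g ord_max).

Lemma path_sum0 w F : path_sum 0 w F = F x0.
Proof.
rewrite /path_sum (big_pred1 [ffun=> x0]) => [|g].
  by rewrite big_ord0 scale1r ffunE.
apply/eqP/eqP => [<-|->]; last by rewrite ffunE.
by apply/ffunP => i; rewrite ffunE ord1.
Qed.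

(** Summing out the last entry absorbs the final step into the terminal function; this drives every
    induction on path length. *)
Lemma path_sumS L w F :
  path_sum L.+1 w F = path_sum L w (fun x => \sum_y w L x y *: F y).
Proof.
rewrite /path_sum (reindex (@ffun_rcons L)) /=; last exact/onW_bij/ffun_rcons_bij.
have rcons0 (g : {ffun 'I_L.+1 -> T}) x : ffun_rcons (g, x) ord0 = g ord0.
  have -> : ord0 = inord 0 :> 'I_L.+2 by apply: val_inj; rewrite /= inordK.
  by rewrite ffun_rcons_inord //; congr (g _); apply: val_inj; rewrite /= inordK.
transitivity (\sum_(g : {ffun 'I_L.+1 -> T} | g ord0 == x0) \sum_x
   (\prod_(t < L) w t (g (inord t)) (g (inord t.+1)) * w L (g ord_max) x) *: F x).
  rewrite pair_big /=; apply: eq_big => [[g x]|[g x] _] /=.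
    by rewrite rcons0 andbT.
  rewrite ffun_rcons_max big_ord_recr /= ffun_rcons_inord //.
  have -> : inord L.+1 = ord_max :> 'I_L.+2 by apply: val_inj; rewrite /= inordK.
  rewrite ffun_rcons_max.
  have -> : inord L = ord_max :> 'I_L.+1 by apply: val_inj; rewrite /= inordK.
  congr ((_ * _) *: _); apply: eq_bigr => t _.
  by rewrite !ffun_rcons_inord // ltnW.
apply: eq_bigr => g _; rewrite scaler_sumr; apply: eq_bigr => x _.
by rewrite scalerA.
Qed.

End PathSums.

(** * Single steps of a Pauli path *)

Section PauliSteps.
Variable R : realType.
Local Notation C := R[i].
Variable n : nat.
Implicit Types (sP : bool * pauli n) (Q : pauli n).

Lemma spmatC sP : (spmat R sP) ^t* = spmat R sP.
Proof. by rewrite trmxCZ pmatC rmorphXn rmorphN1. Qed.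

Lemma spmat_sqr sP : spmat R sP *m spmat R sP = 1%:M.
Proof.
by rewrite -scalemxAl -scalemxAr pmat_sqr scalerA -expr2 sqrr_sign scale1r.
Qed.

(** This makes the sign [s] of an update well defined, so the test in [step_factor] selects the
    right case. *)
Lemma pmat_neq_opp Q Q' : pmat R Q != - pmat R Q'.
Proof.
apply/eqP => eqN.
have eqQ : Q = Q' by apply: (@pmat_scale_inj R n Q Q' (-1)); rewrite ?oppr_eq0 ?oner_eq0 // scaleN1r.
have /eqP := mxtrace_pmat_mul R Q Q.
rewrite {1}eqN {1}eqQ mulNmx linearN /= -eqQ mxtrace_pmat_mul eqxx.
by rewrite eq_sym -addr_eq0 -natrD pnatr_eq0 addn_eq0 expn_eq0.
Qed.

Lemma pmat_inj : injective (@pmat R n).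
Proof.
by move=> P Q eqPQ; apply: (@pmat_scale_inj R n P Q 1); rewrite ?oner_eq0 ?scale1r.
Qed.

(** Extension by zero to forbidden transitions, which lets path sums range over all sequences. *)
Definition step_weight (tau : R) sP Q Q' : C :=
  if step_ok R sP Q Q' then step_factor tau sP Q Q' else 0.

(** Each case lists the whole support of the step weights out of [Q], so a sum over [Q'] collapses
    to one or two terms. *)
Variant step_spec (tau : R) sP Q : Prop :=
| StepAnticomm of spmat R sP *m pmat R Q = - (pmat R Q *m spmat R sP)
    & step_weight tau sP Q Q = 1
    & (forall Q', Q' != Q -> step_weight tau sP Q Q' = 0)
| StepComm Q1 (s : bool) of spmat R sP *m pmat R Q = pmat R Q *m spmat R sP
    & spmat R sP *m pmat R Q = (-1) ^+ s *: pmat R Q1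
    & Q1 != Q
    & step_weight tau sP Q Q = (coshR tau)%:C
    & step_weight tau sP Q Q1 = - ((-1) ^+ s * (sinhR tau)%:C)
    & (forall Q', Q' != Q -> Q' != Q1 -> step_weight tau sP Q Q' = 0).

Lemma stepP (tau : R) sP Q : sP.2 != pauliI n -> step_spec tau sP Q.
Proof.
move=> sP0; set P := spmat R sP.
have PQ0 : P *m pmat R Q != 0.
  apply: contraT; rewrite negbK => /eqP /(congr1 (fun M => \tr (P *m M *m pmat R Q))).
  rewrite mulmx0 mul0mx mxtrace0 mulmxA spmat_sqr mul1mx mxtrace_pmat_mul eqxx.
  by move/eqP; rewrite pnatr_eq0 expn_eq0.
(* Otherwise [2 P Q = 0]; hence exactly one of the tests [commb] and [anticommb] succeeds. *)
have not_both : P *m pmat R Q = pmat R Q *m P ->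
    P *m pmat R Q = - (pmat R Q *m P) -> False.
  move=> PQ; rewrite -PQ => /eqP; rewrite -addr_eq0 -mulr2n -scaler_nat.
  by rewrite scaler_eq0 pnatr_eq0 (negPf PQ0).
have PE : P *m pmat R Q = (-1) ^+ sP.1 *: (pmat R sP.2 *m pmat R Q).
  by rewrite -scalemxAl.
have QPE : pmat R Q *m P = (-1) ^+ sP.1 *: (pmat R Q *m pmat R sP.2).
  by rewrite -scalemxAr.
have [[PQ [Q1 [s PQ1]]]|PQ] := pmat_comm_anticomm R sP.2 Q; last first.
  have aPQ : P *m pmat R Q = - (pmat R Q *m P) by rewrite PE QPE PQ scalerN.
  have cF : commb P (pmat R Q) = false.
    by apply/negP => /eqP PQ'; apply: not_both.
  have aT : anticommb P (pmat R Q) by apply/eqP.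
  apply: StepAnticomm => // [|Q' neQ]; rewrite /step_weight /step_ok /step_factor.
    by rewrite aT cF eqxx.
  by rewrite -/P cF (negPf neQ) !andbF.
have cPQ : P *m pmat R Q = pmat R Q *m P by rewrite PE QPE PQ.
have cT : commb P (pmat R Q) by apply/eqP.
have aF : anticommb P (pmat R Q) = false.
  by apply/negP => /eqP PQ'; apply: not_both.
have PQs : P *m pmat R Q = (-1) ^+ (sP.1 (+) s) *: pmat R Q1.
  by rewrite PE PQ1 scalerA -signr_addb.
(* If [Q1 = Q], cancelling [Q] would make the string of [P] the identity. Thus an update always
   changes the string, which is what [rcount] detects. *)
have neQ1 : Q1 != Q.
  apply: contraNneq sP0 => eQ1; apply/eqP.
  apply: (@pmat_scale_inj R n _ _ ((-1) ^+ s)); first by rewrite signr_eq0.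
  rewrite pmat_pauliI -(pmat_sqr R Q) scalemxAl -eQ1 -PQ1 eQ1.
  by rewrite -mulmxA pmat_sqr mulmx1.
apply: (@StepComm _ _ _ Q1 (sP.1 (+) s)) => //;
  rewrite /step_weight /step_ok /step_factor -/P.
- by rewrite cT aF eqxx.
- rewrite cT aF (negPf neQ1) PQs /=; case: (_ (+) _) => /=.
    by rewrite expr1 scaleN1r eqxx orbT eq_sym (negPf (pmat_neq_opp _ _)) mulN1r opprK.
  by rewrite expr0 scale1r eqxx mul1r.
- move=> Q' neQ' neQ1'; rewrite cT aF (negPf neQ') PQs /=.
  have pF : (pmat R Q1 == pmat R Q') = false by rewrite (inj_eq pmat_inj) eq_sym (negPf neQ1').
  case: (_ (+) _); rewrite ?expr1 ?scaleN1r ?expr0 ?scale1r ?eqr_opp pF ?orbF.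
    by rewrite eq_sym (negPf (pmat_neq_opp _ _)).
  by rewrite (negPf (pmat_neq_opp _ _)).
Qed.

End PauliSteps.

(** * Hyperbolic identities and bounds *)

Section Hyperbolic.
Variable R : realType.
Implicit Types x z : R.

Lemma expR_half x : expR x = expR (x / 2) ^+ 2.
Proof. by rewrite {1}(splitr x) expRD expr2. Qed.

Lemma coshR_half x : coshR (x / 2) ^+ 2 + sinhR (x / 2) ^+ 2 = coshR x.
Proof. by rewrite /coshR /sinhR (expR_half x) (expR_half (- x)) mulNr; field. Qed.

Lemma sinhR_half x : 2 * (coshR (x / 2) * sinhR (x / 2)) = sinhR x.
Proof. by rewrite /coshR /sinhR (expR_half x) (expR_half (- x)) mulNr; field. Qed.

Lemma coshR2B_sinhR2 x : coshR x ^+ 2 - sinhR x ^+ 2 = 1.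
Proof.
have := expRxMexpNx_1 x; rewrite /coshR /sinhR => e1.
by rewrite -[RHS]e1; field.
Qed.

Lemma coshR_ge1 x : 1 <= coshR x.
Proof.
by have := expR_ge1Dx x; have := expR_ge1Dx (- x); rewrite /coshR; lra.
Qed.

Lemma sinhR_ge0 x : 0 <= x -> 0 <= sinhR x.
Proof.
move=> x0; rewrite /sinhR divr_ge0 // subr_ge0 ler_expR.
by lra.
Qed.

Lemma coshR_sinhR_ge0 x z : 0 <= x -> 0 <= z -> 0 <= coshR x + z * sinhR x.
Proof.
move=> x0 z0; apply: addr_ge0; first exact: le_trans ler01 (coshR_ge1 x).
by rewrite mulr_ge0 ?sinhR_ge0.
Qed.

(* Tangent line of expR at x, evaluated at z * x and at - x. *)
Lemma coshR_sinhR_le_expR x z : 0 <= x -> 1 <= z ->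
  coshR x + z * sinhR x <= expR (z * x).
Proof.
move=> x0 z1.
have tangent y : expR x * (1 + (y - x)) <= expR y.
  have -> : expR y = expR x * expR (y - x) by rewrite -expRD subrKC.
  by apply: ler_wpM2l; rewrite ?expR_ge0 ?expR_ge1Dx.
have e1 := tangent (z * x).
have := tangent (- x).
have : 0 <= (z - 1) / 2 by lra.
move=> z0 /(ler_wpM2l z0) e2.
rewrite /coshR /sinhR; lra.
Qed.

End Hyperbolic.

(** * The path expansion and its generating function *)

Section Expansion.
Variable R : realType.
Local Notation C := R[i].
Variable n : nat.
Implicit Types (sP : bool * pauli n) (Q : pauli n) (tau : R).

(** The boolean exponent charges one factor [Z] per update. The commuting case gives equality; in
    the anticommuting case the sum is 1, which is at most [coshR tau]. *)
Lemma step_weight_norm_le tau sP Q (Z : R) : 0 <= tau -> 1 <= Z ->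
  sP.2 != pauliI n ->
  \sum_Q' `|step_weight tau sP Q Q'| * Z%:C ^+ (Q' != Q) <=
    (coshR tau + Z * sinhR tau)%:C.
Proof.
move=> tau0 Z1 sP0.
have sh0 := sinhR_ge0 tau0.
have ch1 := coshR_ge1 tau.
have Z0 : 0 <= Z by lra.
case: (stepP tau Q sP0) => [_ wQ wQ'|Q1 s _ _ neQ1 wQ wQ1 wQ'].
  rewrite (bigD1 Q) //= big1 => [|Q' neQ]; last by rewrite wQ' // normr0 mul0r.
  rewrite wQ eqxx /= normr1 mulr1 addr0 -(rmorph1 (real_complex R)) lecR.
  by rewrite -[1]addr0 lerD // mulr_ge0.
rewrite (bigD1 Q) //= (bigD1 Q1) //= big1 => [|Q' /andP[neQ neQ1']]; last first.
  by rewrite wQ' // normr0 mul0r.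
rewrite wQ wQ1 eqxx neQ1 /= normrN normrM normr_sign mul1r mulr1 addr0 expr1.
rewrite !ger0_norm ?ler0c //; last by lra.
by rewrite -rmorphM -rmorphD lecR [Z * _]mulrC.
Qed.

Lemma conj_real (x : R) : Num.conj (x%:C : C) = x%:C.
Proof. exact: conjc_real. Qed.

Lemma expHalfC tau sP : (expHalf tau sP) ^t* = expHalf tau sP.
Proof.
rewrite /expHalf trmxCB trmxCZ spmatC -scalemx1 trmxCZ trmxC1.
by rewrite !conj_real.
Qed.

Lemma involution_span_mul (K : comPzRingType) m (P : 'M[K]_m) a b c d :
  P *m P = 1%:M ->
  (a%:M + b *: P) *m (c%:M + d *: P) = (a * c + b * d)%:M + (a * d + b * c) *: P.
Proof.
move=> PP; rewrite mulmxDl !mulmxDr -scalar_mxM mul_scalar_mx mul_mx_scalar.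
rewrite -scalemxAl -scalemxAr PP !scalerA scalemx1 raddfD scalerDl /=.
by rewrite (mulrC c b) [X in _ + X]addrC !addrA; congr (_ + _); rewrite addrAC.
Qed.

Lemma expHalfE tau sP : expHalf tau sP =
  (coshR (tau / 2))%:C%:M + (- (sinhR (tau / 2))%:C) *: spmat R sP.
Proof. by rewrite scaleNr. Qed.

Lemma expHalf_sqr tau sP : expHalf tau sP *m expHalf tau sP =
  (coshR tau)%:C%:M - (sinhR tau)%:C *: spmat R sP.
Proof.
rewrite expHalfE involution_span_mul ?spmat_sqr // -scaleNr.
congr (_%:M + _ *: _).
  by rewrite -(coshR_half tau) rmorphD !rmorphXn /= mulrNN !expr2.
by rewrite -(sinhR_half tau) !rmorphM rmorph_nat /=; ring.
Qed.

Lemma expHalf_mul_opp tau sP :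
  ((coshR (tau / 2))%:C%:M + (sinhR (tau / 2))%:C *: spmat R sP) *m
  expHalf tau sP = 1%:M.
Proof.
rewrite expHalfE involution_span_mul ?spmat_sqr //.
set c := _%:C; set s := _%:C.
have -> : c * - s + s * c = 0 by ring.
rewrite scale0r addr0.
have -> : c * c + s * - s = (coshR (tau / 2) ^+ 2 - sinhR (tau / 2) ^+ 2)%:C.
  by rewrite rmorphB !rmorphXn /= !expr2 mulrN.
by rewrite coshR2B_sinhR2.
Qed.

(** Moving the left half-exponential through an anticommuting [Q] flips its sign, so it cancels the
    right one; through a commuting [Q] the two merge into [cosh tau - sinh tau P]. *)
Lemma Emap_pmat tau sP Q : sP.2 != pauliI n ->
  Emap tau sP (pmat R Q) = \sum_Q' step_weight tau sP Q Q' *: pmat R Q'.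
Proof.
move=> sP0; case: (stepP tau Q sP0) => [PQ wQ wQ'|Q1 s PQ PQ1 neQ1 wQ wQ1 wQ'].
  rewrite (bigD1 Q) //= big1 => [|Q' neQ]; last by rewrite wQ' // scale0r.
  rewrite wQ scale1r addr0 /Emap.
  have -> : expHalf tau sP *m pmat R Q =
      pmat R Q *m ((coshR (tau / 2))%:C%:M + (sinhR (tau / 2))%:C *: spmat R sP).
    rewrite mulmxBl mulmxDr scalar_mxC; congr (_ + _).
    by rewrite -scalemxAl PQ scalerN opprK scalemxAr.
  by rewrite -mulmxA expHalf_mul_opp mulmx1.
rewrite (bigD1 Q) //= (bigD1 Q1) //= big1 => [|Q' /andP[neQ neQ1']]; last first.
  by rewrite wQ' // scale0r.
rewrite wQ wQ1 addr0 /Emap.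
have -> : expHalf tau sP *m pmat R Q = pmat R Q *m expHalf tau sP.
  by rewrite mulmxBl mulmxBr scalar_mxC -scalemxAl PQ scalemxAr.
rewrite -mulmxA expHalf_sqr mulmxBr mul_mx_scalar -scalemxAr -PQ PQ1 scalerA.
by rewrite scaleNr [_%:C * _]mulrC.
Qed.

Lemma Emap_sum (I : finType) (p : pred I) (c : I -> C) (X : I -> 'M[C]_(2 ^ n)) tau sP :
  Emap tau sP (\sum_(i | p i) c i *: X i) = \sum_(i | p i) c i *: Emap tau sP (X i).
Proof.
rewrite /Emap mulmx_sumr mulmx_suml; apply: eq_bigr => i _.
by rewrite -scalemxAr -scalemxAl.
Qed.

Lemma Aiter_path_sum tau (Ps : nat -> bool * pauli n) L :
  (forall t, (t < L)%N -> (Ps t.+1).2 != pauliI n) ->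
  Aiter tau Ps L =
  path_sum (pauliI n) L (fun t => step_weight tau (Ps t.+1)) (@pmat R n).
Proof.
elim: L => [|L IH] Ps0; first by rewrite path_sum0 pmat_pauliI.
rewrite path_sumS /= IH => [|t ltL]; last exact/Ps0/ltnW.
rewrite Emap_sum; apply: eq_bigr => g _.
by rewrite Emap_pmat // Ps0.
Qed.

Lemma prod_step_weight tau (Ps : nat -> bool * pauli n) L (g : ppath n L) :
  g ord0 = pauliI n ->
  \prod_(t < L) step_weight tau (Ps t.+1) (g (inord t)) (g (inord t.+1)) =
  if is_path R Ps g then coef tau Ps g else 0.
Proof.
move=> g0; rewrite /is_path g0 eqxx /=; case: forallP => [ok|/forallP].
  by apply: eq_bigr => t _; rewrite /step_weight ok.
rewrite negb_forall => /existsP[t okF].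
by rewrite (bigD1 t) //= /step_weight (negPf okF) mul0r.
Qed.

Lemma Aiter_expansion tau (Ps : nat -> bool * pauli n) L :
  (forall t, (t < L)%N -> (Ps t.+1).2 != pauliI n) ->
  Aiter tau Ps L =
  \sum_(g : ppath n L | is_path R Ps g) coef tau Ps g *: pmat R (g ord_max).
Proof.
move=> Ps0; rewrite Aiter_path_sum // /path_sum [LHS]big_mkcond [RHS]big_mkcond.
apply: eq_bigr => g _; case: eqP => [g0|/eqP g0]; last first.
  by rewrite /is_path (negPf g0).
by rewrite prod_step_weight //; case: ifP => // _; rewrite scale0r.
Qed.

Lemma Aiter_sub_Atrunc tau (Ps : nat -> bool * pauli n) L k :
  (forall t, (t < L)%N -> (Ps t.+1).2 != pauliI n) ->
  Aiter tau Ps L - Atrunc L tau Ps k =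
  \sum_(g : ppath n L | is_path R Ps g && (k < rcount g)%N)
     coef tau Ps g *: pmat R (g ord_max).
Proof.
move=> Ps0; rewrite Aiter_expansion // (bigID (fun g => rcount g <= k)%N) /=.
by rewrite addrC addrK; apply: eq_bigl => g; rewrite ltnNge.
Qed.

Lemma expr_rcount (Z : C) L (g : ppath n L) :
  Z ^+ rcount g = \prod_(t < L) Z ^+ (g (inord t.+1) != g (inord t)).
Proof.
rewrite -expr_sum /rcount -sum1_card; congr (_ ^+ _).
by rewrite big_mkcond; apply: eq_bigr => t _; rewrite inE; case: (_ != _).
Qed.

(** The weight with [Z ^+ rcount g] is multiplicative along the path, hence a [path_sum] with
    terminal function 1; each peeled step costs one row-sum bound. *)
Lemma path_gen_le tau (Z : R) (Ps : nat -> bool * pauli n) L :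
  0 <= tau -> 1 <= Z -> (forall t, (t < L)%N -> (Ps t.+1).2 != pauliI n) ->
  \sum_(g : ppath n L | is_path R Ps g) `|coef tau Ps g| * Z%:C ^+ rcount g <=
  ((coshR tau + Z * sinhR tau) ^+ L)%:C.
Proof.
move=> tau0 Z1 Ps0.
have Z0 : 0 <= Z by lra.
pose w t Q Q' := `|step_weight tau (Ps t.+1) Q Q'| * Z%:C ^+ (Q' != Q).
have w_ge0 t Q Q' : 0 <= w t Q Q'.
  by apply: mulr_ge0; [exact: normr_ge0 | apply: exprn_ge0; rewrite ler0c].
have -> : \sum_(g : ppath n L | is_path R Ps g) `|coef tau Ps g| * Z%:C ^+ rcount g
    = path_sum (pauliI n) L w (fun=> 1 : C^o).
  rewrite /path_sum [LHS]big_mkcond [RHS]big_mkcond; apply: eq_bigr => g _.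
  case: eqP => [g0|/eqP g0]; last by rewrite /is_path (negPf g0).
  rewrite big_split /= -normr_prod -expr_rcount prod_step_weight // [RHS]mulr1.
  by case: ifP => // _; rewrite normr0 mul0r.
elim: L Ps0 => [|L IH] Ps0; first by rewrite path_sum0 expr0.
rewrite path_sumS exprSr rmorphM.
apply: le_trans (_ : path_sum (pauliI n) L w (fun=> 1 : C^o) *
   (coshR tau + Z * sinhR tau)%:C <= _); last first.
  apply: ler_wpM2r; last by apply: IH => t ltL; apply/Ps0/ltnW.
  by rewrite ler0c coshR_sinhR_ge0.
rewrite mulr_suml; apply: ler_sum => g _.
rewrite -mulrA; apply: ler_wpM2l; first by apply: prodr_ge0 => t _.
rewrite mul1r.
have -> : \sum_y w L (g ord_max) y *: (1 : C^o) = \sum_y w L (g ord_max) y.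
  by apply: eq_bigr => Q _; rewrite [LHS]mulr1.
exact: step_weight_norm_le tau0 Z1 (Ps0 _ _).
Qed.

(** Chernoff argument: on discarded paths [Z ^+ k <= Z ^+ rcount g], so [Z ^+ k] times the tail is
    at most the full generating function. *)
Lemma coef_tail_le tau (Z : R) (Ps : nat -> bool * pauli n) L k :
  0 <= tau -> 1 <= Z -> (forall t, (t < L)%N -> (Ps t.+1).2 != pauliI n) ->
  \sum_(g : ppath n L | is_path R Ps g && (k < rcount g)%N) `|coef tau Ps g| <=
  (expR (Z * tau * L%:R) / Z ^+ k)%:C.
Proof.
move=> tau0 Z1 Ps0.
have Z0 : 0 < Z by lra.
rewrite rmorphM fmorphV ler_pdivlMr; last by rewrite ltcR exprn_gt0.
apply: le_trans (_ : ((coshR tau + Z * sinhR tau) ^+ L)%:C <= _); last first.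
  rewrite lecR expRM_natr; apply: lerXn2r; rewrite ?nnegrE ?expR_ge0 //.
    by rewrite coshR_sinhR_ge0 ?(ltW Z0).
  exact: coshR_sinhR_le_expR.
apply: le_trans (path_gen_le tau0 Z1 Ps0).
rewrite big_mkcondr mulr_suml /=; apply: ler_sum => g _.
case: ifP => [ltk|_]; last by rewrite mul0r mulr_ge0 ?exprn_ge0 // ler0c ltW.
rewrite rmorphXn; apply: ler_wpM2l => //; apply: ler_weXn2l (ltnW ltk).
by rewrite -(rmorph1 (real_complex R)) lecR.
Qed.

End Expansion.

(** * Trace bounds for the exact operator and for the discarded paths *)

Section TraceBounds.
Variable R : realType.
Local Notation C := R[i].
Variable n : nat.
Implicit Types (tau : R) (Ps : nat -> bool * pauli n).

(** Each step multiplies by the same Hermitian matrix on both sides, so it multiplies [M] on the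
    left. This encodes positivity of the iterate. *)
Lemma Aiter_gram tau Ps t : exists M : 'M[C]_(2 ^ n), Aiter tau Ps t = M *m M ^t*.
Proof.
elim: t => [|t [M AE]] /=; first by exists 1%:M; rewrite trmxC1 mulmx1.
exists (expHalf tau (Ps t.+1) *m M).
by rewrite /Emap AE trmxCM expHalfC !mulmxA.
Qed.

(** As [P] is a Hermitian involution, [(1 + P) / 2] is an orthogonal projector, and the projector
    bound rearranges to the claim. *)
Lemma mxtrace_spmat_gram_le (sP : bool * pauli n) (M : 'M[C]_(2 ^ n)) :
  \tr (spmat R sP *m M *m M ^t* ) <= \tr (M *m M ^t* ).
Proof.
have two_neq0 : (2 : C) != 0 by rewrite pnatr_eq0.
pose p := 2^-1 *: (1%:M + spmat R sP).
have uu : (1%:M + spmat R sP) *m (1%:M + spmat R sP) = 2 *: (1%:M + spmat R sP).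
  rewrite mulmxDl mul1mx mulmxDr mulmx1 spmat_sqr.
  by rewrite [spmat _ _ + _]addrC scaler_nat mulr2n.
have pp : p *m p = p.
  by rewrite -scalemxAl -scalemxAr uu scalerK ?unitfE.
have pC : p ^t* = p.
  rewrite trmxCZ linearD /= map_mxD trmxC1 spmatC; congr (_ *: _).
  by rewrite fmorphV rmorph_nat.
have := hsnorm2_mul_projector M pp pC.
rewrite /hsnorm2 -2!scalemxAl linearZ /= !mulmxDl mul1mx linearD /=.
rewrite mulrC ler_pdivrMr ?ltr0n // mulrDr mulr1.
by rewrite lerD2l.
Qed.

(** By cyclicity one step yields [cosh tau * \tr A - sinh tau * \tr (P A)], and [\tr (P A) <= \tr A]
    leaves at least the factor [cosh tau - sinh tau], that is [expR (- tau)]. *)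
Lemma mxtrace_Aiter_ge tau Ps t : 0 <= tau ->
  (2 ^ n)%:R * (expR (- (tau * t%:R)))%:C <= \tr (Aiter tau Ps t).
Proof.
move=> tau0; elim: t => [|t IH] /=.
  by rewrite mulr0 oppr0 expR0 mxtrace1 mulr1.
have [M AE] := Aiter_gram tau Ps t.
rewrite /Emap mxtrace_mulC mulmxA expHalf_sqr mulmxBl raddfB /=.
rewrite mul_scalar_mx -scalemxAl !mxtraceZ.
apply: le_trans (_ : (expR (- tau))%:C * \tr (Aiter tau Ps t) <= _).
  rewrite -[t.+1]addn1 natrD mulrDr mulr1 opprD expRD rmorphM mulrA mulrC.
  by apply: ler_wpM2l; rewrite ?ler0c ?expR_ge0.
have -> : expR (- tau) = coshR tau - sinhR tau by rewrite /coshR /sinhR; field.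
rewrite rmorphB mulrBl lerD2l lerN2; apply: ler_wpM2l.
  by rewrite ler0c sinhR_ge0.
by rewrite AE mulmxA; apply: mxtrace_spmat_gram_le.
Qed.

Lemma mxtrace_mul_pmat_le (W : 'M[C]_(2 ^ n)) (Q : pauli n) :
  hsnorm2 W <= (2 ^ n)%:R -> `|\tr (W *m pmat R Q)| <= (2 ^ n)%:R.
Proof.
move=> W1; rewrite -[X in _ <= X]sqrtCK expr2.
apply: mxtrace_CauchySchwarz_le; rewrite ?sqrtCK ?sqrtC_ge0 ?ler0n //.
by rewrite /hsnorm2 pmatC pmat_sqr mxtrace1.
Qed.

(** Cauchy-Schwarz between [W M] and the adjoint of [M]. *)
Lemma mxtrace_mul_gram_le m (W M : 'M[C]_m) :
  hsnorm2 (W *m M) <= hsnorm2 M ->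
  `|\tr (W *m (M *m M ^t* ))| <= \tr (M *m M ^t* ).
Proof.
move=> WM; rewrite -/(hsnorm2 M) -[X in _ <= X]sqrtCK expr2 mulmxA.
by apply: mxtrace_CauchySchwarz_le;
  rewrite ?sqrtCK ?hsnorm2_trmxC ?sqrtC_ge0 ?hsnorm2_ge0.
Qed.

(** Leaving [W] free serves two uses: the identity bounds the difference of traces, the dual witness
    the trace norm. *)
Lemma mxtrace_mul_tail_le tau Ps L k (Z : R) (W : 'M[C]_(2 ^ n)) :
  0 <= tau -> 1 <= Z -> (forall t, (t < L)%N -> (Ps t.+1).2 != pauliI n) ->
  hsnorm2 W <= (2 ^ n)%:R ->
  `|\tr (W *m (Aiter tau Ps L - Atrunc L tau Ps k))| <=
    (expR (Z * tau * L%:R) / Z ^+ k)%:C * (2 ^ n)%:R.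
Proof.
move=> tau0 Z1 Ps0 W1; rewrite Aiter_sub_Atrunc // mulmx_sumr linear_sum /=.
apply: le_trans (ler_norm_sum _ _ _) _.
apply: le_trans (ler_wpM2r (ler0n _ _) (coef_tail_le k tau0 Z1 Ps0)).
rewrite mulr_suml; apply: ler_sum => g _.
rewrite -scalemxAr linearZ normrM; apply: ler_wpM2l => //.
exact: mxtrace_mul_pmat_le.
Qed.

End TraceBounds.

(** * Normalization and assembly of the error bound *)

Lemma normalized_diff_le (F : numFieldType) (a b x y e : F) :
  0 < a -> 0 <= e -> e < 1 ->
  `|a - b| <= e * a -> `|x - y| <= e * a -> `|x| <= a ->
  `|a^-1 * x - b^-1 * y| <= 2 * e / (1 - e).
Proof.
move=> a0 e0 e1 ab xy xa.
have b_ge : (1 - e) * a <= `|b|.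
  rewrite mulrBl mul1r lerBlDr -{1}(gtr0_norm a0) -lerBlDl.
  by apply: le_trans ab; apply: lerB_dist.
have e1' : 0 < 1 - e by rewrite subr_gt0.
have b_gt0 : 0 < `|b| by apply: lt_le_trans b_ge; rewrite mulr_gt0.
have b0 : b != 0 by rewrite -normr_gt0.
(* As [x / a] has modulus at most 1, each summand of the numerator is at most [e * a], against a
   denominator of at least [(1 - e) * a]. *)
have -> : a^-1 * x - b^-1 * y = (x - y + (b - a) * (x / a)) / b.
  by field; rewrite b0 gt_eqF.
rewrite normrM normfV ler_pdivrMr //.
apply: le_trans (_ : 2 * e * a <= _); last first.
  rewrite -[X in _ <= X]mulrA; apply: ler_wpM2l; first by rewrite mulr_ge0.
  by rewrite mulrC ler_pdivlMr // mulrC.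
rewrite -mulrA [2 * _]mulrDl mul1r; apply: le_trans (ler_normD _ _) _.
apply: lerD => //; rewrite normrM distrC -[X in _ <= X]mulr1.
apply: ler_pM => //; rewrite normrM normfV (gtr0_norm a0).
by rewrite ler_pdivrMr // mul1r.
Qed.

(* Chernoff bound on the number of updates: the parameter is Z = k / x. *)
Lemma chernoff_optimum (R : realType) (x : R) k : 0 < x ->
  expR (k%:R / x * x) / (k%:R / x) ^+ k = (expR 1 * x / k%:R) ^+ k.
Proof.
move=> x0; rewrite divfK ?gt_eqF // -[X in expR X]mulr1 expRM_natl -exprVn -exprMn.
by rewrite invf_div mulrA.
Qed.

Theorem mainTheorem8 (R : realType) (n : nat) (beta Lambda : R) (L k : nat)
    (Ps : nat -> bool * pauli n) :
  (1 <= n)%N -> 0 < beta -> 0 < Lambda -> (1 <= L)%N ->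
  (forall t, (1 <= t <= L)%N -> (Ps t).2 != pauliI n) ->
  expR 1 * beta * Lambda / 2 < k%:R ->
  let tau := beta * Lambda / (2 * L%:R) in
  let rho := normalize (Aiter tau Ps L) in
  let rhot := normalize (Atrunc L tau Ps k) in
  let eps := expR (beta * Lambda / 2) *
             (expR 1 * beta * Lambda / (2 * k%:R)) ^+ k in
  eps < 1 ->
  trnorm (rho - rhot) <= 2 * eps / (1 - eps) /\
  (forall O : 'M[R[i]]_(2 ^ n), O ^t* = O ->
     `|\tr (O *m (rho - rhot))| <= (opnorm O * (2 * eps / (1 - eps)))%:C).
Proof.
move=> _ beta0 Lambda0 L0 PsI ltk tau rho rhot eps eps1.
suff tr_le : trnorm (rho - rhot) <= 2 * eps / (1 - eps).
  split=> // O _; apply: le_trans (mxtrace_mul_opnorm_trnorm _ _) _.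
  by rewrite lecR ler_wpM2l ?opnorm_ge0.
have L_gt0 : 0 < L%:R :> R by rewrite ltr0n.
pose x := beta * Lambda / 2.
have x0 : 0 < x by rewrite divr_gt0 ?mulr_gt0.
have tauL : tau * L%:R = x by rewrite /tau /x; field; rewrite gt_eqF.
have tau0 : 0 <= tau by rewrite divr_ge0 ?mulr_ge0 ?ltW.
have e1 : 1 <= expR 1 :> R by have := expR_ge1Dx (1 : R); lra.
(* From [k > e * x] and [e >= 1]; it makes the Chernoff parameter [k / x] at least 1. *)
have ltxk : x < k%:R.
  apply: le_lt_trans ltk; rewrite -2!mulrA (mulrA beta) -/x.
  by apply: ler_peMl => //; apply: ltW.
have k0 : 0 < k%:R :> R by apply: lt_trans ltxk.
have Z1 : 1 <= k%:R / x by rewrite ler_pdivlMr // mul1r ltW.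
have Ps0 t : (t < L)%N -> (Ps t.+1).2 != pauliI n by move=> ltL; apply: PsI.
set eta := (expR 1 * x / k%:R) ^+ k.
have epsE : eps = expR x * eta.
  rewrite /eps /eta; congr (_ * _ ^+ _); rewrite /x; field.
  by rewrite gt_eqF.
have eps0 : 0 <= eps.
  rewrite epsE mulr_ge0 ?expR_ge0 //; apply/exprn_ge0/divr_ge0/ltW => //.
  by rewrite mulr_ge0 ?expR_ge0 // ltW.
clearbody eps.
set A := Aiter tau Ps L in rho *; set A' := Atrunc L tau Ps k in rhot *.
have A_ge : (2 ^ n)%:R * (expR (- x))%:C <= \tr A.
  by rewrite -tauL mxtrace_Aiter_ge.
have A0 : 0 < \tr A.
  apply: lt_le_trans A_ge; apply: mulr_gt0; first by rewrite ltr0n expn_gt0.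
  by rewrite ltcR expR_gt0.
(* The factor [expR x] in [eps] pays for replacing [2 ^ n] by the trace, which is at least
   [2 ^ n * expR (- x)]. *)
have tail W : hsnorm2 W <= (2 ^ n)%:R -> `|\tr (W *m (A - A'))| <= eps%:C * \tr A.
  move=> W1; apply: le_trans (mxtrace_mul_tail_le k tau0 Z1 Ps0 W1) _.
  rewrite -mulrA tauL chernoff_optimum // -/eta.
  apply: le_trans (_ : eps%:C * ((2 ^ n)%:R * (expR (- x))%:C) <= _).
    rewrite mulrCA -rmorphM epsE mulrAC expRxMexpNx_1 mul1r mulrC.
    exact: lexx.
  by apply: ler_wpM2l; rewrite ?ler0c.
have [W [WX W1 Wc]] := trnorm_dual (rho - rhot).
have [M AE] := Aiter_gram tau Ps L.
have cE : (2 * eps / (1 - eps))%:C = 2 * eps%:C / (1 - eps%:C).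
  by rewrite !rmorphM fmorphV rmorphB rmorph1 rmorph_nat.
(* The trace norm becomes a complex trace against [W], bounded by its modulus, so that
   [normalized_diff_le] applies with [x] and [y] the traces of [W A] and [W A']. *)
rewrite -lecR cE -WX; apply: le_trans (real_ler_norm _) _.
  by rewrite WX; apply/CrealP; rewrite conj_real.
have -> : \tr (W *m (rho - rhot)) =
    (\tr A)^-1 * \tr (W *m A) - (\tr A')^-1 * \tr (W *m A').
  by rewrite mulmxBr raddfB /= -!scalemxAr !mxtraceZ.
apply: normalized_diff_le => //.
- by rewrite ler0c.
- by rewrite -(rmorph1 (real_complex R)) ltcR.
- rewrite -raddfB -[A - A']mul1mx /=; apply: tail.
  by rewrite /hsnorm2 trmxC1 mulmx1 mxtrace1.
- by rewrite -raddfB -mulmxBr /=; apply: tail.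
- by rewrite /A AE; apply: mxtrace_mul_gram_le.
Qed.
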